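(* Let $(\mathbb{V},\mathbb{W},\lambda)$ be a finite-dimensional FTvN system with $\mathcal{K}:=\lambda(\mathbb{V})$, let $(\mathbb{W},\mathbb{W},\mu)$ be a reduced system of $(\mathbb{V},\mathbb{W},\lambda)$, and let $\mathcal{C}\subseteq\mathbb{W}$ be a nonempty spectral set in $(\mathbb{W},\mathbb{W},\mu)$. (i) For any convex $\mathcal{D}$ that satisfies $\mathsf{conv}(\mathcal{C}\cap\mathcal{K})\subseteq\mathcal{D}\subseteq(\mathsf{conv}\,\mathcal{C})\cap\mathcal{K}$, we have $\mathsf{conv}\,\lambda^{-1}(\mathcal{C})=\lambda^{-1}(\mathcal{D}+\mathcal{K}^\circ)$. (ii) For any convex $\mathcal{D}$ that satisfies $\mathsf{conv}(\mathcal{C}\cap\mathcal{K})\subseteq\mathcal{D}\subseteq(\mathsf{clconv}\,\mathcal{C})\cap\mathcal{K}$, we have $\mathsf{clconv}\,\lambda^{-1}(\mathcal{C})=\mathsf{cl}\,\lambda^{-1}(\mathcal{D}+\mathcal{K}^\circ)$.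
   Context: Let $\mathbb{V},\mathbb{W}$ be finite-dimensional real inner-product spaces and $\lambda:\mathbb{V}\to\mathbb{W}$ a (generally nonlinear) map. $(\mathbb{V},\mathbb{W},\lambda)$ is called an FTvN system if: (P1) $\langle x,y\rangle\le\langle\lambda(x),\lambda(y)\rangle$ for all $x,y\in\mathbb{V}$; and (P2) for all $c\in\mathbb{V}$ and $u\in\lambda(\mathbb{V})$ there exists $x\in\mathbb{V}$ such that $\lambda(x)=u$ and $\langle c,x\rangle=\langle\lambda(c),\lambda(x)\rangle$. In this case the range $\mathcal{K}:=\lambda(\mathbb{V})\subseteq\mathbb{W}$ is known to be a nonempty closed convex cone. Its polar cone is $\mathcal{K}^\circ:=\{y\in\mathbb{W}:\langle y,x\rangle\le 0\ \forall x\in\mathcal{K}\}$. An FTvN system $(\mathbb{W},\mathbb{W},\mu)$ is called a reduced system of $(\mathbb{V},\mathbb{W},\lambda)$ if $\mu(u)=u$ for all $u\in\mathcal{K}$ and $\mu(\mathbb{W})=\lambda(\mathbb{V})=\mathcal{K}$. A set $\mathcal{C}\subseteq\mathbb{W}$ is spectral in $(\mathbb{W},\mathbb{W},\mu)$ if $\mathcal{C}=\mu^{-1}(\mathcal{Q})$ for some $\mathcal{Q}\subseteq\mathbb{W}$. $\lambda^{-1}(\mathcal{A})$, $\mu^{-1}(\mathcal{A})$ denote preimages of a set $\mathcal{A}\subseteq\mathbb{W}$. $\mathsf{conv}$, $\mathsf{cl}$ and $\mathsf{clconv}$ denote convex hull, closure and closed convex hull; sums of sets are Minkowski sums. *)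

(* Defs.v *)
From HB Require Import structures.
From mathcomp Require Import all_boot all_order all_algebra.
From mathcomp Require Import all_classical all_reals all_analysis.

Set Implicit Arguments.
Unset Strict Implicit.
Unset Printing Implicit Defensive.

Import Order.TTheory GRing.Theory Num.Theory.
Import numFieldNormedType.Exports.

Local Open Scope classical_set_scope.
Local Open Scope ring_scope.

(* [euclideanType R]: finite-dimensional real inner-product spaces (not
   coordinatized); finite dimension is [Vector], and [norm_inner] makes the
   library's norm, hence its topology, the one induced by [inner]. *)
HB.mixin Record NormedModule_isInner (R : realType) V
    & NormedModule R V := {
  inner : {dot V for idfun};
  norm_inner : forall x : V, `|x| ^+ 2 = inner x x
}.

#[short(type="euclideanType")]
HB.structure Definition Euclidean (R : realType) :=
  {V of NormedModule R V & Vector R V & NormedModule_isInner R V}.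

Section Hulls.
Context {R : realType} {V : normedModType R}.
Implicit Types A B : set V.

Definition conv_hull A : set V := smallest (@convex_set R V) A.

Definition clconv_hull A : set V :=
  smallest (fun B : set V => closed B /\ convex_set B) A.

Definition minkowski_sum A B : set V := [set a + b | a in A & b in B].

End Hulls.

Definition polar_cone (R : realType) (W : euclideanType R) (K : set W) :
    set W :=
  [set y | forall x, K x -> inner y x <= 0].

Definition FTvN_system (R : realType) (V W : euclideanType R)
    (lam : V -> W) : Prop :=
  (forall x y, inner x y <= inner (lam x) (lam y)) /\
  (forall c u, range lam u ->
     exists x, lam x = u /\ inner c x = inner (lam c) (lam x)).

Definition reduced_system (R : realType) (V W : euclideanType R)
    (lam : V -> W) (mu : W -> W) : Prop :=
  [/\ FTvN_system mu,
      forall u, range lam u -> mu u = u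
    & range mu = range lam].

Definition spectral_set (R : realType) (W : euclideanType R)
    (mu : W -> W) (C : set W) : Prop :=
  exists Q : set W, C = mu @^-1` Q.

(* Main.v *)
(** Both sides are compared through linear functionals. By (P2), the defect
[lam (s x + t y) - (s lam x + t lam y)] lies in the polar cone of [range lam],
so the preimage of [D + K°] is convex, which gives the inclusions from left to
right. Conversely, (P1) gives [<c, x> <= <lam c, d>] as soon as [lam x] lies in
[d + K°], while (P1) for [mu] and (P2) for [lam] provide for every [u] in [C]
some [y] in [lam^-1 C] with [<lam c, u> <= <c, y>]. Hence no functional [c] can
strictly separate such an [x] from the closed convex hull of [lam^-1 C]. In (i),
where no closure is taken, [d] is a combination of finitely many points of [C]
and only a compact subset [A] of [lam^-1 C] is involved, whose convex hull is
closed by Carathéodory's theorem. *)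

Require Import Defs.
From mathcomp Require Import all_boot all_order all_algebra.
From mathcomp Require Import all_classical all_reals all_analysis.
From mathcomp Require Import ring lra.
Import Order.TTheory GRing.Theory Num.Theory.
Import numFieldNormedType.Exports.

Local Open Scope classical_set_scope.
Local Open Scope ring_scope.

Set Implicit Arguments.
Unset Strict Implicit.

(** * Convexity of hulls and closures *)

Section ConvexSets.
Context {R : realType} {V : normedModType R}.
Implicit Types A B : set V.

(** Unpacks the interval-typed scalars of [convex_set] into a real [t] with explicit bounds, the
    form that arithmetic tactics can use. *)
Lemma convex_setP A :
  convex_set A <-> forall x y (t : R), 0 <= t -> t <= 1 ->
    A x -> A y -> A (t *: x + (1 - t) *: y).
Proof.
split=> [cA x y t t0 t1 Ax Ay|cA x y t].
  have tP : Itv.spec (@Itv.num_sem R) (Itv.Real `[0%Z, 1%Z]) t.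
    by rewrite /= /Itv.num_sem/= num_real/= in_itv/= t0 t1.
  have := cA x y (Itv.mk tP); rewrite !inE; exact.
by rewrite !inE => Ax Ay; apply: cA; rewrite ?ge0 ?le1.
Qed.

Lemma convex_conv_hull A : convex_set (conv_hull A).
Proof.
apply/convex_setP => x y t t0 t1 Ax Ay M [cM AM].
by move/convex_setP: (cM); apply => //; [exact: Ax|exact: Ay].
Qed.

Lemma convex_clconv_hull A : convex_set (clconv_hull A).
Proof.
apply/convex_setP => x y t t0 t1 Ax Ay M [[clM cM] AM].
by move/convex_setP: (cM); apply => //; [exact: Ax|exact: Ay].
Qed.

Lemma closed_clconv_hull A : closed (clconv_hull A).
Proof. by apply: closed_bigI => M [[]]. Qed.

Lemma convex_closure A : convex_set A -> convex_set (closure A).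
Proof.
move=> /convex_setP cA; apply/convex_setP => x y t t0 t1 clx cly B nB.
have cont : continuous (fun p : V * V => t *: p.1 + (1 - t) *: p.2).
  move=> p; apply: cvgD; apply: cvgZ;
    [exact: cvg_cst|exact: cvg_fst|exact: cvg_cst|exact: cvg_snd].
have [[P Q] /= [nP nQ] PQB] := cont (x, y) B nB.
have [a [Aa Pa]] := clx P nP; have [b [Ab Qb]] := cly Q nQ.
exists (t *: a + (1 - t) *: b); split; first exact: cA.
exact: (PQB (a, b)).
Qed.

End ConvexSets.

(** * Sums of [n] terms with coefficients in a prescribed set *)

Section WeightedSums.
Context {R : realFieldType} {U : lmodType R}.
Implicit Types (I : set R) (B : set U).

(** Recursion on the number of terms suits the induction for compactness. The coefficient set [I] is
    the half-line for cones and [[0, 1]] for compactness. *)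
Fixpoint weighted_sum I n B : set U :=
  if n is k.+1 then
    [set v | exists w t b, [/\ weighted_sum I k B w, I t, B b & v = w + t *: b]]
  else [set 0].

Lemma weighted_sumP I n B v : weighted_sum I n B v <->
  exists (b : 'I_n -> U) (t : 'I_n -> R),
    [/\ forall i, B (b i), forall i, I (t i) & v = \sum_i t i *: b i].
Proof.
elim: n v => [|n IH] v /=; split.
- by move=> ->; exists (fun=> 0), (fun=> 0); split=> [[]|[]|] //; rewrite big_ord0.
- by move=> [b [t [_ _ ->]]]; rewrite big_ord0.
- move=> [w [s [c [/IH[b [t [Bb It ->]]] Is Bc ->]]]].
  exists (fun i => oapp b c (unlift ord_max i)).
  exists (fun i => oapp t s (unlift ord_max i)).
  split=> [i|i|].
  - by case: unliftP => [j _|_] /=; [exact: Bb|exact: Bc].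
  - by case: unliftP => [j _|_] /=; [exact: It|exact: Is].
  rewrite big_ord_recr /= unlift_none /=; congr (_ + _); apply: eq_bigr => i _.
  by have -> : widen_ord (leqnSn n) i = lift ord_max i;
    [apply: val_inj; rewrite /= /bump leqNgt ltn_ord|rewrite liftK].
- move=> [b [t [Bb It ->]]]; rewrite big_ord_recr /=.
  exists (\sum_i t (widen_ord (leqnSn n) i) *: b (widen_ord (leqnSn n) i)).
  exists (t ord_max), (b ord_max); split => //; apply/IH.
  by exists (b \o widen_ord (leqnSn n)), (t \o widen_ord (leqnSn n)); split=> [i|i|] /=.
Qed.

(** Short sums are padded with a fixed point of [B] taken with coefficient [0]. *)
Lemma sub_weighted_sum I m n B : I 0 -> B !=set0 -> (m <= n)%N ->
  weighted_sum I m B `<=` weighted_sum I n B.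
Proof.
move=> I0 [b Bb] /subnKC <-; elim: (n - m)%N => [|k IH]; first by rewrite addn0.
rewrite addnS; apply: subset_trans IH _ => v kv.
by exists v, 0, b; split; rewrite // scale0r addr0.
Qed.

Lemma weighted_sumD I m n B u v : weighted_sum I m B u ->
  weighted_sum I n B v -> weighted_sum I (m + n) B (u + v).
Proof.
move=> mu; elim: n v => [|n IH] v /=; first by move=> ->; rewrite addn0 addr0.
move=> [w [t [b [/IH wn It Bb ->]]]]; rewrite addnS.
by exists (u + w), t, b; split; rewrite // addrA.
Qed.

Lemma weighted_sumZ I n B s v : (forall t, I t -> I (s * t)) ->
  weighted_sum I n B v -> weighted_sum I n B (s *: v).
Proof.
move=> Is; elim: n v => [|n IH] v /=; first by move=> ->; rewrite scaler0.
move=> [w [t [b [/IH wn It Bb ->]]]].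
by exists (s *: w), (s * t), b; split; rewrite ?scalerDr ?scalerA //; exact: Is.
Qed.

End WeightedSums.

Notation conic_sum := (weighted_sum [set t | 0 <= t]).

(** * Carathéodory's theorem for cones *)

Section Caratheodory.
Context {R : realFieldType} {U : vectType R}.
Implicit Type B : set U.

(** More vectors than the dimension are linearly dependent; the relation is negated if its known
    nonzero coefficient is negative. *)
Lemma positive_dependence n (b : 'I_n -> U) : (\dim {:U} < n)%N ->
  exists c : 'I_n -> R,
    (exists i, 0 < c i) /\ \sum_i c i *: b i = 0.
Proof.
move=> Un; pose X := [tuple b i | i < n].
have XE (i : 'I_n) : X`_i = b i by rewrite -tnth_nth tnth_mktuple.
have /freeP nfree : ~~ free X.
  apply/negP; rewrite /free => /eqP dimX.
  by have := dimvS (subvf <<X>>%VS); rewrite dimX size_tuple leqNgt Un.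
have [c [c0 [i ci]]] : exists c : 'I_n -> R,
    \sum_i c i *: b i = 0 /\ exists i, c i != 0.
  apply: contrapT => nc; apply: nfree => c c0 i; apply: contrapT => /eqP ci.
  apply: nc; exists c; split; last by exists i.
  by rewrite -[RHS]c0; apply: eq_bigr => j _; rewrite XE.
move: ci; rewrite neq_lt => /orP[ci|ci]; last by exists c; split => //; exists i.
exists (fun j => - c j); split; first by exists i; rewrite oppr_gt0.
by under eq_bigr do rewrite scaleNr; rewrite sumrN c0 oppr0.
Qed.

(** Subtracting from [t] the multiple [r] of a dependence [c], where [r] is the least ratio
    [t i / c i] over [c i > 0], keeps all coefficients nonnegative and makes one vanish. *)
Lemma caratheodory_step n B : (\dim {:U} <= n)%N ->
  conic_sum n.+1 B `<=` conic_sum n B.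
Proof.
move=> Un v /weighted_sumP[b [t [Bb t0 ->]]].
have [c [[i0 ci0] c0]] := positive_dependence b (Un : (\dim {:U} < n.+1)%N).
have [i ci imin] := @arg_minP _ _ _ i0 (fun i => 0 < c i) (fun i => t i / c i) ci0.
pose r := t i / c i.
have r0 : 0 <= r by rewrite divr_ge0 ?(ltW ci) //; exact: t0.
apply/weighted_sumP; exists (b \o lift i), (fun j => t (lift i j) - r * c (lift i j)).
split=> [j|j|]; first exact: Bb.
  rewrite /= subr_ge0; set k := lift i j; have [ck|ck] := ltP 0 (c k).
    by rewrite -ler_pdivlMr //; exact: imin.
  by apply: le_trans (t0 k : 0 <= t k); rewrite mulr_ge0_le0.
transitivity (\sum_k (t k - r * c k) *: b k).
  under [RHS]eq_bigr do rewrite scalerBl -scalerA.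
  by rewrite sumrB -scaler_sumr c0 scaler0 subr0.
by rewrite (bigD1_ord i) //= /r divfK ?gt_eqF // subrr scale0r add0r.
Qed.

Lemma caratheodory n B : B !=set0 ->
  conic_sum n B `<=` conic_sum (\dim {:U}) B.
Proof.
move=> B0; have [nU|/ltnW Un] := leqP n (\dim {:U}).
  by apply: sub_weighted_sum => //=.
rewrite -(subnKC Un); elim: (_ - _)%N => [|k IH]; first by rewrite addn0.
by rewrite addnS; apply: subset_trans IH; apply: caratheodory_step; rewrite leq_addr.
Qed.

End Caratheodory.

(** * Closedness of the convex hull of a compact set *)

Section ClosedConvexHull.
Context {R : realType} {V : normedModType R}.

Lemma compact_weighted_sum (I : set R) n (B : set V) :
  compact I -> compact B -> compact (weighted_sum I n B).
Proof.
move=> cI cB; elim: n => [|n IH]; first exact: compact_set1.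
pose f (p : (V * R^o) * V) := p.1.1 + p.1.2 *: p.2.
have -> : weighted_sum I n.+1 B = f @` ((weighted_sum I n B `*` I) `*` B).
  apply/seteqP; split=> v /=.
  - by move=> [w [t [b [nw It Bb ->]]]]; exists ((w, t), b).
  - by move=> [[[w t] b] [[/= nw It] Bb] <-]; exists w, t, b.
apply: continuous_compact; last exact: compact_setX (compact_setX IH cI) cB.
apply: continuous_subspaceT => p; apply: cvgD; last apply: cvgZ.
- by apply: (@continuous_comp _ _ _ fst fst); exact: cvg_fst.
- by apply: (@continuous_comp _ _ _ fst snd); [exact: cvg_fst|exact: cvg_snd].
- exact: cvg_snd.
Qed.

Implicit Type A : set V.

(* Convex combinations in [A] are the conic combinations in [A `*` [set 1]] at
   height [1], so Carathéodory's theorem is only needed for cones. *)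
Local Notation lift1 A := (A `*` [set 1] : set (V * R^o)).

Lemma conic_sum_ge0 n A p : conic_sum n (lift1 A) p -> 0 <= p.2.
Proof.
elim: n p => [|n IH] p /=; first by move=> ->.
move=> [w [t [b [/IH w0 t0 [_ /= b1] ->]]]] /=.
by rewrite b1 addr_ge0 // mulr_ge0.
Qed.

Lemma conv_hullP A v :
  conv_hull A v <-> exists n, conic_sum n (lift1 A) (v, 1).
Proof.
split.
  apply: (@smallest_sub _ _ _ [set v | exists n, conic_sum n (lift1 A) (v, 1)])
    => [|a Aa /=]; last first.
    exists 1%N, 0, 1, (a, 1); split => //=.
    by rewrite add0r scale1r.
  apply/convex_setP => x y t t0 t1 [m mx] [n ny]; exists (m + n)%N.
  have -> : (t *: x + (1 - t) *: y, 1) = t *: (x, 1) + (1 - t) *: (y, 1) :> V * R^o.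
    by congr (_, _); rewrite /= /GRing.scale /=; lra.
  by apply: weighted_sumD; apply: weighted_sumZ => // s s0 /=;
    rewrite mulr_ge0 // subr_ge0.
move=> [n].
(* Induction needs arbitrary heights: a conic sum is zero or its height times a point of the
   hull. *)
have hullE p : conic_sum n (lift1 A) p ->
    p = 0 \/ exists2 w, conv_hull A w & p.1 = p.2 *: w.
  elim: n p => [|n IH] p /=; first by left.
  move=> [w [t [[a b1] [nw t0 [/= Aa ->] -> {p}]]]]; have w0 := conic_sum_ge0 nw.
  have Ha : conv_hull A a by exact: sub_gen_smallest.
  right; have [->|[u Hu wE]] := IH _ nw.
    by exists a => //=; rewrite /GRing.scale /= !add0r mulr1.
  have [s0|s0] := eqVneq (w.2 + t) 0.
    have [/eqP w20 /eqP t20] : w.2 == 0 /\ t == 0 by split; apply/eqP; lra.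
    by exists a => //=; rewrite wE w20 t20 !(scale0r, addr0).
  exists ((w.2 / (w.2 + t)) *: u + (1 - w.2 / (w.2 + t)) *: a).
    have /convex_setP := @convex_conv_hull _ _ A; apply=> //.
      by rewrite divr_ge0 // addr_ge0.
    by rewrite ler_pdivrMr ?mul1r ?lerDl // lt_neqAle eq_sym s0 addr_ge0.
  rewrite /= wE {4}/GRing.scale /= mulr1 scalerDr !scalerA.
  by congr (_ *: _ + _ *: _); field.
move=> /hullE[[_ /eqP]|[w Hw /= ->]]; first by rewrite oner_eq0.
by rewrite scale1r.
Qed.

(** Partial sums have nonnegative height and generators have height [1], so a total height at most
    [1] bounds each coefficient. The half-line is thus replaced by a compact interval. *)
Lemma conic_sum_le1 n A p : p.2 <= 1 -> conic_sum n (lift1 A) p ->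
  weighted_sum `[0, 1]%classic n (lift1 A) p.
Proof.
elim: n p => [//|n IH] p p1 /= [w [t [[a b1] [nw t0 [/= Aa b1E] pE]]]].
have w0 := conic_sum_ge0 nw.
have {p1} : w.2 + t <= 1 by move: p1; rewrite pE /= b1E /GRing.scale /= mulr1.
move=> wt1; exists w, t, (a, b1); split => //; last by rewrite /= in_itv /= t0; lra.
by apply: IH => //; lra.
Qed.

End ClosedConvexHull.

(** For nonempty [A], Carathéodory bounds the number of terms by [N], the dimension of [V * R^o], so
    the hull is the height-one slice of a compact set. *)
Lemma closed_conv_hull_compact (R : realType) (V : euclideanType R) (A : set V) :
  compact A -> closed (conv_hull A).
Proof.
move=> cA; have [->|/set0P A0] := eqVneq A set0.
  rewrite /conv_hull smallest_id; first exact: closed0.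
  by apply/convex_setP.
pose B : set (V * R^o) := A `*` [set 1].
pose N := (\dim {: (V * R^o)%type})%N.
have -> : conv_hull A =
    (fun v => (v, 1)) @^-1` weighted_sum `[0, 1]%classic N B.
  apply/seteqP; split=> v /=.
    move=> /conv_hullP[n nv]; apply: conic_sum_le1 => //.
    apply: (caratheodory _ nv).
    by case: A0 => a Aa; exists (a, 1).
  move=> Nv; apply/conv_hullP; exists N.
  move: Nv; rewrite -/B; elim: N {cA A0} (v, 1) => [//|n IH] p /=.
  move=> [w [t [b [/IH nw /=]]]]; rewrite in_itv /= => /andP[t0 _] Bb ->.
  by exists w, t, b.
apply: preimage_closed => [v _|].
  have c1 : cst (1 : R^o) @ v --> (1 : R^o) by exact: cvg_cst.
  exact: cvg_pair cvg_id c1.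
apply: compact_closed; first exact: norm_hausdorff.
apply: compact_weighted_sum; first exact: segment_compact.
by apply: compact_setX => //; exact: compact_set1.
Qed.

(** * Compactness and separation in Euclidean spaces *)

Lemma continuous_sum (R : realType) (V : normedModType R) (T : topologicalType)
    (I : Type) (s : seq I) (f : I -> T -> V) :
  (forall i, continuous (f i)) -> continuous (fun x => \sum_(i <- s) f i x).
Proof.
move=> cf; elim: s => [|i s IH].
  rewrite (_ : (fun x => _) = cst 0); first exact: cst_continuous.
  by apply/funext => x; rewrite big_nil.
rewrite (_ : (fun x => _) = (fun x => f i x + \sum_(i <- s) f i x)).
  by move=> x; apply: cvgD; [exact: cf|exact: IH].
by apply/funext => x; rewrite big_cons.
Qed.

Section Euclidean.
Context {R : realType} {V : euclideanType R}.
Implicit Types (x y z : V) (t : R).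

Lemma innerC x y : inner x y = inner y x.
Proof. by rewrite hermC expr0 mul1r. Qed.

Lemma innerDl x y z : inner (x + y) z = inner x z + inner y z.
Proof. exact: linearDl. Qed.

Lemma innerZl t x z : inner (t *: x) z = t * inner x z.
Proof. exact: linearZl_LR. Qed.

Lemma innerBl x y z : inner (x - y) z = inner x z - inner y z.
Proof. exact: linearBl. Qed.

Lemma innerDr x y z : inner x (y + z) = inner x y + inner x z.
Proof. by rewrite innerC innerDl !(innerC x). Qed.

Lemma innerZr t x z : inner x (t *: z) = t * inner x z.
Proof. by rewrite innerC innerZl innerC. Qed.

Lemma innerBr x y z : inner x (y - z) = inner x y - inner x z.
Proof. by rewrite innerC innerBl !(innerC x). Qed.

Lemma normDE x y : `|x + y| ^+ 2 = `|x| ^+ 2 + `|y| ^+ 2 + 2 * inner x y.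
Proof. by rewrite !norm_inner innerDl !innerDr (innerC y x); ring. Qed.

Lemma normBE x y : `|x - y| ^+ 2 = `|x| ^+ 2 + `|y| ^+ 2 - 2 * inner x y.
Proof. by rewrite !norm_inner innerBl !innerBr (innerC y x); ring. Qed.

Lemma inner_continuous x : continuous (inner x : V -> R).
Proof.
(* Polarization reduces the claim to continuity of the norm. *)
have -> : (inner x : V -> R) =
    (fun y => 2^-1 * (`|x + y| ^+ 2 - `|x| ^+ 2 - `|y| ^+ 2)).
  by apply/funext => y; rewrite normDE; field.
move=> y.
have cN (f : V -> V) : {for y, continuous f} ->
    {for y, continuous (fun z => `|f z| ^+ 2)}.
  move=> cf; apply: (@continuous_comp _ _ _ _ (fun s : R => s ^+ 2));
    last exact: exprn_continuous.
  by apply: continuous_comp cf _; exact: norm_continuous.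
apply: cvgM; first exact: cvg_cst.
apply: cvgB; last exact: (cN id cvg_id).
apply: cvgB; last exact: cvg_cst.
apply: (cN (fun z => x + z)); apply: cvgD; [exact: cvg_cst|exact: cvg_id].
Qed.

Import VectorInternalTheory.
Let n := dim V.

Let r2v_continuous : continuous (@r2v R V).
Proof.
have -> : (@r2v R V) =
    (fun u => \sum_(j <- enum 'I_n) u 0 j *: @r2v R V (delta_mx 0 j)).
  apply/funext => u; rewrite {1}(row_sum_delta u) (linear_sum (@r2v R V)) big_enum.
  by apply: eq_bigr => j _; rewrite linearZ.
apply: continuous_sum => j u.
apply: (@continuous_comp _ _ _ (fun v : 'rV[R]_n => v 0 j) ( *:%R^~ _)).
  exact: coord_continuous.
exact: scalel_continuous.
Qed.

(** [m] is the minimum of the norm of [r2v] on the compact unit sphere of coordinates, positive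
    because [r2v] is injective. *)
Let r2v_norm_ge : exists2 m : R, 0 < m & forall u : 'rV[R]_n, m * `|u| <= `|@r2v R V u|.
Proof.
pose S := [set u : 'rV[R]_n | `|u| = 1].
have NS (u : 'rV[R]_n) : u != 0 -> S (`|u|^-1 *: u).
  by move=> u0; rewrite /S /= normrZ normfV normr_id mulVf ?normr_eq0.
(* The sphere is empty only in dimension zero. *)
have [S0|/set0P S0] := eqVneq S set0.
  exists 1 => // u; have [->|/NS] := eqVneq u 0; last by rewrite S0.
  by rewrite normr0 mulr0.
have cS : compact S.
  apply: bounded_closed_compact.
    by exists 1; split; rewrite ?num_real // => M M1 u /= ->; exact: ltW.
  apply: (@preimage_closed _ _ _ [set 1 : R]); last exact: closed_eq.
  by move=> u _; exact: norm_continuous.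
have cf : {within S, continuous (fun u : 'rV[R]_n => `|@r2v R V u|)}.
  apply: continuous_subspaceT => u.
  by apply: continuous_comp (@r2v_continuous u) _; exact: norm_continuous.
have [u0 Su0 umin] := compact_EVT_min S0 cS cf.
exists `|@r2v R V u0|.
  rewrite normr_gt0 -(linear0 (@r2v R V)) (can_eq r2vK).
  move: Su0; rewrite inE /S /= => u01; apply/eqP => u00.
  by move: u01; rewrite u00 normr0 => /eqP; rewrite eq_sym oner_eq0.
move=> u; have [->|u0'] := eqVneq u 0; first by rewrite normr0 mulr0.
have := umin _ (mem_set (NS _ u0')).
by rewrite linearZ normrZ normfV normr_id mulrC ler_pdivlMr ?normr_gt0.
Qed.

(** Heine-Borel, transported from row vectors along [r2v]. *)
Lemma closed_bounded_compact (A : set V) M :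
  closed A -> (forall x, A x -> `|x| <= M) -> compact A.
Proof.
move=> clA AM; have [m m0 mP] := r2v_norm_ge.
have -> : A = (@r2v R V) @` (@r2v R V @^-1` A).
  apply/seteqP; split=> [x Ax|_ [u Au <-] //].
  by exists (v2r x); rewrite /= v2rK.
apply: continuous_compact.
  by apply: continuous_subspaceT; exact: r2v_continuous.
apply: bounded_closed_compact; last first.
  by apply: preimage_closed clA => u _; exact: r2v_continuous.
exists (M / m); split; rewrite ?num_real // => N MN u /= Au.
apply: le_trans (ltW MN); rewrite ler_pdivlMr // mulrC.
by apply: le_trans (mP u) _; exact: AM.
Qed.

(** The separating functional is [x - s1], where [s1] is a point of [S] nearest to [x]. *)
Lemma convex_separation (S : set V) x : S !=set0 -> closed S -> convex_set S ->
  ~ S x -> exists c b, (forall y, S y -> inner c y <= b) /\ b < inner c x.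
Proof.
(* Intersecting [S] with the ball [T] makes it compact, so the distance attains its minimum. *)
move=> [s0 Ss0] clS cS Sx; pose T := [set s | `|x - s| <= `|x - s0|].
have cd : continuous (fun s => `|x - s|).
  move=> s; apply: (@continuous_comp _ _ _ (fun s => x - s)); last exact: norm_continuous.
  by apply: cvgB; [exact: cvg_cst|exact: cvg_id].
have cST : compact (S `&` T).
  apply: (@closed_bounded_compact _ (`|x - s0| + `|x|)).
    apply: closedI => //; apply: (@preimage_closed _ _ _ [set r : R | r <= `|x - s0|]).
      by move=> s _; exact: cd.
    exact: closed_le.
  move=> s [_ Ts]; have -> : s = x - (x - s) by rewrite subKr.
  by apply: le_trans (ler_normB _ _) _; rewrite addrC lerD2r.
have ST0 : (S `&` T) !=set0 by exists s0; split; rewrite // /T /=.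
have [s1] := compact_EVT_min ST0 cST (continuous_subspaceT cd).
rewrite inE => -[Ss1 Ts1] min1.
have {}min1 y : S y -> `|x - s1| <= `|x - y|.
  move=> Sy; have [Ty|/ltW] := leP `|x - y| `|x - s0|; last exact: le_trans.
  by apply: min1; rewrite inE.
exists (x - s1), (inner (x - s1) s1); split; last first.
  rewrite -subr_gt0 -innerBr -norm_inner exprn_gt0 // normr_gt0 subr_eq0.
  by apply: contra_notN Sx => /eqP ->.
move=> y Sy; rewrite -subr_le0 -innerBr leNgt; apply/negP.
set q := inner _ _ => q0; pose N := `|y - s1| ^+ 2.
have N0 : 0 <= N by rewrite exprn_ge0.
(* Moving from [s1] towards [y] by [t] changes the squared distance to [x] by
   [t * (t * N) - 2 * t * q], negative since this [t] satisfies [t * N <= q]. *)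
pose t := q / (q + N).
have t0 : 0 < t by rewrite divr_gt0 // ltr_wpDr.
have t1 : t <= 1 by rewrite ler_pdivrMr ?mul1r ?lerDl // ltr_wpDr.
have tN : t * N <= q.
  rewrite /t mulrAC ler_pdivrMr ?ltr_wpDr //.
  by rewrite ler_pM2l // lerDr ltW.
have := min1 (t *: y + (1 - t) *: s1).
move=> /(_ (iffLR (convex_setP S) cS _ _ _ (ltW t0) t1 Sy Ss1)).
have -> : t *: y + (1 - t) *: s1 = s1 + t *: (y - s1).
  by rewrite scalerBr scalerBl scale1r addrCA.
rewrite opprD addrA.
rewrite -(@ler_pXn2r _ 2) ?nnegrE // (normBE (x - s1)) innerZr -/q normrZ.
rewrite exprMn (gtr0_norm t0) -/N.
have : t * (t * N) < t * (2 * q) by rewrite ltr_pM2l //; lra.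
lra.
Qed.

End Euclidean.

(** * Consequences of (P1) and (P2) *)

Section FTvN.
Context {R : realType} {V W : euclideanType R} (lam : V -> W).
Hypothesis hlam : FTvN_system lam.

(** (P1) on the diagonal gives one inequality. For the other, (P2) gives [y] with the same image as
    [x] and [inner x y] equal to the squared norm of [lam x]; then expand the square of [x - y]. *)
Lemma FTvN_norm x : `|lam x| = `|x|.
Proof.
have [P1 P2] := hlam.
have norm_le y : `|y| ^+ 2 <= `|lam y| ^+ 2 by rewrite !norm_inner.
apply/eqP; rewrite -(@eqrXn2 _ 2) //; apply/eqP/le_anti; rewrite norm_le andbT.
have [|y [yx]] := P2 x (lam x); first by exists x.
rewrite yx -norm_inner => xy.
have := norm_le y; have : 0 <= `|x - y| ^+ 2 by rewrite exprn_ge0.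
rewrite normBE yx xy; lra.
Qed.

Lemma FTvN_continuous : continuous lam.
Proof.
have [P1 _] := hlam.
(* Norms are preserved and inner products do not decrease, so distances do not increase. *)
have lip x y : `|lam x - lam y| <= `|x - y|.
  rewrite -(@ler_pXn2r _ 2) ?nnegrE // !normBE !FTvN_norm.
  by have := P1 x y; lra.
move=> x; apply/cvgrPdist_lt => e e0; near=> y.
apply: le_lt_trans (lip _ _) _; near: y.
by have /cvgrPdist_lt := @cvg_id _ (nbhs x); apply.
Unshelve. all: by end_near. Qed.

Lemma FTvN_subadditive x y s t : 0 <= s -> 0 <= t ->
  polar_cone (range lam) (lam (s *: x + t *: y) - (s *: lam x + t *: lam y)).
Proof.
move=> s0 t0 _ [z _ <-]; have [P1 P2] := hlam.
(* [c] has the image of [z] and attains equality against the combination, while (P1) bounds its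
   products with [x] and [y] separately. *)
have [|c [cz max]] := P2 (s *: x + t *: y) (lam z); first by exists z.
rewrite -cz innerBl -max subr_le0 !innerDl !innerZl.
by rewrite lerD // ler_wpM2l.
Qed.

Lemma polar_coneD (K : set W) p q :
  polar_cone K p -> polar_cone K q -> polar_cone K (p + q).
Proof.
by move=> Kp Kq k Kk; rewrite innerDl -(addr0 0) lerD //; [exact: Kp|exact: Kq].
Qed.

Lemma polar_coneZ (K : set W) t p : 0 <= t ->
  polar_cone K p -> polar_cone K (t *: p).
Proof. by move=> t0 Kp k Kk; rewrite innerZl mulr_ge0_le0 //; exact: Kp. Qed.

Lemma polar_cone0 (K : set W) : polar_cone K 0.
Proof. by move=> k Kk; rewrite (linear0l inner). Qed.

Lemma convex_FTvN_preimage (D : set W) : convex_set D ->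
  convex_set (lam @^-1` minkowski_sum D (polar_cone (range lam))).
Proof.
move=> /convex_setP cD; apply/convex_setP => x y t t0 t1.
move=> [d Dd [p Kp dpE]] [e De [q Kq eqE]].
have t1' : 0 <= 1 - t by rewrite subr_ge0.
exists (t *: d + (1 - t) *: e); first exact: cD.
(* The polar part also absorbs the defect of [lam] on the combination. *)
exists (t *: p + (1 - t) *: q +
    (lam (t *: x + (1 - t) *: y) - (t *: lam x + (1 - t) *: lam y))).
  by apply: polar_coneD (FTvN_subadditive _ _ t0 t1');
    apply: polar_coneD; exact: polar_coneZ.
by rewrite -dpE -eqE !scalerDr addrA [t *: d + t *: p + _]addrACA addrC subrK.
Qed.

Lemma FTvN_inner_le_preimage (D : set W) x c :
  (lam @^-1` minkowski_sum D (polar_cone (range lam))) x ->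
  exists2 d, D d & inner c x <= inner (lam c) d.
Proof.
move=> [d Dd [p Kp dp]]; exists d => //; apply: le_trans (hlam.1 c x) _.
rewrite -dp innerDr gerDl innerC; apply: Kp; exact: imageT.
Qed.

End FTvN.

(** * Reduced systems and spectral sets *)

Section Reduced.
Context {R : realType} {V W : euclideanType R} {lam : V -> W} {mu : W -> W}.
Hypotheses (hlam : FTvN_system lam) (hmu : reduced_system lam mu).

Lemma reduced_range u : range lam (mu u).
Proof. by case: hmu => _ _ <-; exact: imageT. Qed.

(** [mu] is idempotent, since it fixes its own range. *)
Lemma spectral_mu (C : set W) u : spectral_set mu C -> C u -> C (mu u).
Proof.
move=> [Q ->] Qu; rewrite /preimage /=; case: hmu => _ -> //.
exact: reduced_range.
Qed.

Lemma reduced_orbit_max c u : exists y,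
  lam y = mu u /\ inner (lam c) u <= inner c y.
Proof.
(* Here [inner c y] equals [inner (lam c) (mu u)], and (P1) for [mu] applies because [mu] fixes
   [lam c]. *)
have [y [yu cy]] := hlam.2 c _ (reduced_range u); exists y; split => //.
case: hmu => -[P1 _] muE _.
by rewrite cy yu -[in leRHS](muE (lam c)) //; exact: imageT.
Qed.

Lemma compact_fiber u : compact (lam @^-1` [set u]).
Proof.
apply: (@closed_bounded_compact _ _ _ `|u|).
  apply: preimage_closed => [x _|]; first exact: FTvN_continuous.
  by apply: compact_closed; [exact: norm_hausdorff|exact: compact_set1].
by move=> x /= <-; rewrite FTvN_norm.
Qed.

(** One compact [A] must serve all [c]. Points of [C] use the fiber over [mu u], and convex
    combinations use unions, so the property passes to the hull by minimality. *)
Lemma conv_hull_compact_witness (C : set W) d : spectral_set mu C ->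
  conv_hull C d -> exists A : set V,
    [/\ A !=set0, compact A, A `<=` lam @^-1` C &
     forall c, exists2 y, A y & inner (lam c) d <= inner c y].
Proof.
move=> hC; move: d; apply: (@smallest_sub _ _ _ [set d | exists A : set V,
    [/\ A !=set0, compact A, A `<=` lam @^-1` C &
     forall c, exists2 y, A y & inner (lam c) d <= inner c y]]); last first.
  move=> u Cu; exists (lam @^-1` [set mu u]); split.
  - by have [y [yu _]] := reduced_orbit_max 0 u; exists y.
  - exact: compact_fiber.
  - by move=> y /= ->; exact: spectral_mu.
  - by move=> c; have [y []] := reduced_orbit_max c u; exists y.
apply/convex_setP => d e t t0 t1 [A [[a Aa] cA AC Ad]] [B [_ cB BC Be]].
exists (A `|` B); split.
- by exists a; left.
- exact: compactU.
- by move=> y [/AC|/BC].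
move=> c; have [y Ay cy] := Ad c; have [z Bz cz] := Be c.
(* The larger of the two values dominates their convex combination. *)
have [yz|/ltW zy] := leP (inner c y) (inner c z).
  exists z; first by right.
  rewrite innerDr !innerZr; nra.
exists y; first by left.
by rewrite innerDr !innerZr; nra.
Qed.

Lemma preimage_sub_conv_hull (C D : set W) : spectral_set mu C -> D `<=` conv_hull C ->
  lam @^-1` minkowski_sum D (polar_cone (range lam)) `<=` conv_hull (lam @^-1` C).
Proof.
move=> hC DC x [d Dd dp].
have [A [[a Aa] cA AC Ad]] := conv_hull_compact_witness hC (DC _ Dd).
apply: (sub_smallest2r (@convex_conv_hull _ _ _) AC).
apply: contrapT => nx.
have clA : closed (conv_hull A) by exact: closed_conv_hull_compact.
have [|c [b [cb bx]]] :=
  convex_separation _ clA (@convex_conv_hull _ _ _) nx.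
  by exists a; exact: sub_gen_smallest.
(* The singleton in place of [D] forces the bound at the very [d] from which [A] was built. *)
have [_ -> cd] : exists2 d', [set d] d' & inner c x <= inner (lam c) d'.
  by apply: FTvN_inner_le_preimage => //; exists d.
have [y Ay cy] := Ad c.
by have := cb _ (sub_gen_smallest Ay); lra.
Qed.

Lemma preimage_sub_clconv_hull (C D : set W) : C !=set0 -> spectral_set mu C ->
  D `<=` clconv_hull C ->
  lam @^-1` minkowski_sum D (polar_cone (range lam)) `<=`
    clconv_hull (lam @^-1` C).
Proof.
move=> [u0 Cu0] hC DC x xD; apply: contrapT => nx.
have orbit c u : C u -> exists y,
    clconv_hull (lam @^-1` C) y /\ inner (lam c) u <= inner c y.
  move=> Cu; have [y [yu cy]] := reduced_orbit_max c u; exists y; split => //.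
  by apply: sub_gen_smallest; rewrite /preimage /= yu; exact: spectral_mu.
have [|c [b [cb bx]]] := convex_separation _ (@closed_clconv_hull _ _ _)
    (@convex_clconv_hull _ _ _) nx.
  by have [y [Cy _]] := orbit 0 _ Cu0; exists y.
have [d Dd cd] := FTvN_inner_le_preimage hlam c xD.
(* The bound [b] on the hull upstairs transfers to [C] through [orbit], then to its closed convex
   hull, which contains [d]. *)
have halfspace : clconv_hull C `<=` [set w | inner (lam c) w <= b].
  apply: smallest_sub => [|u Cu /=]; last first.
    by have [y [/cb yb]] := orbit c _ Cu; move/le_trans; apply.
  split.
    apply: (@preimage_closed _ _ _ [set r : R | r <= b]); last exact: closed_le.
    by move=> w _; exact: inner_continuous.
  apply/convex_setP => v w t t0 t1 /= vb wb; rewrite innerDr !innerZr; nra.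
by have /= := halfspace _ (DC _ Dd); lra.
Qed.

End Reduced.

Theorem corollary3p1 (R : realType) (V W : euclideanType R)
    (lam : V -> W) (mu : W -> W) (C : set W)
    (K := range lam)
    (hlam : FTvN_system lam)
    (hmu : reduced_system lam mu)
    (hC : spectral_set mu C)
    (C0 : C !=set0) :
  (forall D : set W, convex_set D ->
     conv_hull (C `&` K) `<=` D -> D `<=` conv_hull C `&` K ->
     conv_hull (lam @^-1` C) =
       lam @^-1` (minkowski_sum D (polar_cone K))) /\
  (forall D : set W, convex_set D ->
     conv_hull (C `&` K) `<=` D -> D `<=` clconv_hull C `&` K ->
     clconv_hull (lam @^-1` C) =
       closure (lam @^-1` (minkowski_sum D (polar_cone K)))).
Proof.
(* Shared by both parts: [lam x] itself lies in [D], with polar part [0]. *)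
have fiber_sub D : conv_hull (C `&` K) `<=` D ->
    lam @^-1` C `<=` lam @^-1` minkowski_sum D (polar_cone K).
  move=> CKD x Cx; exists (lam x).
    apply: CKD; apply: sub_gen_smallest.
    by split => //; exact: imageT.
  by exists 0; rewrite ?addr0 //; exact: polar_cone0.
split=> D cD CKD; rewrite subsetI => -[DC _]; apply/seteqP; split.
- by apply: smallest_sub; [exact: convex_FTvN_preimage|exact: fiber_sub].
- exact: (preimage_sub_conv_hull hlam hmu hC DC).
- apply: smallest_sub; last exact: subset_trans (fiber_sub _ CKD) (@subset_closure _ _).
  split; first exact: closed_closure.
  by apply: convex_closure; exact: convex_FTvN_preimage.
- rewrite closureE; apply: smallest_sub; first exact: closed_clconv_hull.
  exact: (preimage_sub_clconv_hull hlam hmu C0 hC DC).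
Qed.
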